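(* Let $\lambda_1,\dots,\lambda_N\in\mathbb{C}$ be pairwise distinct with $\operatorname{Im}\lambda_i>0$, and let $Q_d(\lambda_1),\dots,Q_d(\lambda_N)\in\mathbb{C}\setminus\{0\}$ be prescribed. For $i=1,\dots,N$ put $$A_i=1,\qquad B_i=-\frac{Q_d(\lambda_i)}{\lambda_i-\lambda_i^*}\prod_{k=1,\,k\neq i}^N\frac{\lambda_i-\lambda_k}{\lambda_i-\lambda_k^*},\qquad v_i^{(0)}(t)=\left(A_ie^{-j\lambda_it},\,B_ie^{j\lambda_it}\right)^T,$$ and $q^{(0)}=0$. For $i=1,\dots,N$ successively, put $(\psi_1,\psi_2)^T=v_i^{(i-1)}(t)$, $$q^{(i)}(t)=q^{(i-1)}(t)-2j(\lambda_i-\lambda_i^* )\frac{\psi_2^*(t)\psi_1(t)}{|\psi_1(t)|^2+|\psi_2(t)|^2},$$ and, for $k=i+1,\dots,N$, define $v_k^{(i)}=(v_{k,1}^{(i)},v_{k,2}^{(i)})^T$ by $$v_{k,1}^{(i)}=\left(\lambda_k-\lambda_i^*-\frac{(\lambda_i-\lambda_i^* )|\psi_1|^2}{|\psi_1|^2+|\psi_2|^2}\right)v_{k,1}^{(i-1)}-\frac{(\lambda_i-\lambda_i^* )\psi_2^*\psi_1}{|\psi_1|^2+|\psi_2|^2}\,v_{k,2}^{(i-1)},$$ $$v_{k,2}^{(i)}=-\frac{(\lambda_i-\lambda_i^* )\psi_2\psi_1^*}{|\psi_1|^2+|\psi_2|^2}\,v_{k,1}^{(i-1)}+\left(\lambda_k-\lambda_i+\frac{(\lambda_i-\lambda_i^*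 )|\psi_1|^2}{|\psi_1|^2+|\psi_2|^2}\right)v_{k,2}^{(i-1)}.$$ Then the resulting signal $q=q^{(N)}$ has exactly the prescribed discrete spectrum: its eigenvalues in $\mathbb{C}^+$ are $\lambda_1,\dots,\lambda_N$, and its discrete spectral amplitude at $\lambda_i$ equals the prescribed value $Q_d(\lambda_i)$ for each $i=1,\dots,N$.
   Context: Notation: $j=\sqrt{-1}$, $x^*$ is the complex conjugate of $x$, $\mathbb{C}^+$ is the upper half complex plane. For a complex-valued signal $q(t)$, $t\in\mathbb{R}$, decaying sufficiently fast as $|t|\to\infty$, and $\lambda\in\mathbb{C}^+$ or $\lambda\in\mathbb{R}$, let $\phi^{\mathrm N}(t;\lambda)=(\phi^{\mathrm N}_1,\phi^{\mathrm N}_2)^T$ be the solution of $$\frac{\partial}{\partial t}\phi=\begin{pmatrix}-j\lambda&q(t)\\-q^*(t)&j\lambda\end{pmatrix}\phi,\qquad \phi^{\mathrm N}(t;\lambda)\sim\begin{pmatrix}1\\0\end{pmatrix}e^{-j\lambda t}\ \text{ as } t\to-\infty .$$ The scattering functions are $a(\lambda)=\lim_{t\to+\infty}e^{j\lambda t}\phi^{\mathrm N}_1(t;\lambda)$ and $b(\lambda)=\lim_{t\to+\infty}e^{-j\lambda t}\phi^{\mathrm N}_2(t;\lambda)$ ($b$ being considered for $\lambda\in\mathbb{R}$ and for $\lambda\in\mathbb{C}^+$ with $a(\lambda)=0$). The eigenvalues of $q$ in $\mathbb{C}^+$ are the zeros $\lambda_i\in\mathbb{C}^+\setminus\mathbb{R}$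 of $a$, and the discrete spectral amplitude of $q$ at such an eigenvalue is $b(\lambda_i)/a'(\lambda_i)$, where $a'=da/d\lambda$. The discrete spectrum is the collection of the eigenvalues with their discrete spectral amplitudes. *)

(* Defs.v *)
From Stdlib Require Import Reals List Arith.
From Coquelicot Require Import Coquelicot.
Open Scope C_scope.

(* Coquelicot has no complex exponential. *)
Definition Cexp (z : C) : C :=
  (exp (Re z) * cos (Im z), exp (Re z) * sin (Im z))%R.

(* The system is  phi' = ((- j lambda, q), (- q^*, j lambda)) phi, and
   phi ~ (1, 0)^T e^{- j lambda t} at -oo means that e^{j lambda t} phi tends
   to the vector (1, 0)^T. *)
Definition is_jost_solution (q : R -> C) (lambda : C) (phi : R -> C * C) : Prop :=
  (forall t : R,
     is_derive (fun s : R => fst (phi s) : C) t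
       (- Ci * lambda * fst (phi t) + q t * snd (phi t)) /\
     is_derive (fun s : R => snd (phi s) : C) t
       (- Cconj (q t) * fst (phi t) + Ci * lambda * snd (phi t))) /\
  filterlim (fun t : R => Cexp (Ci * lambda * t) * fst (phi t))
    (Rbar_locally m_infty) (locally (1 : C)) /\
  filterlim (fun t : R => Cexp (Ci * lambda * t) * snd (phi t))
    (Rbar_locally m_infty) (locally (0 : C)).

(* The scattering data are introduced as relations, so that no junk value is
   ever attributed to a missing solution, limit or derivative.  Uniqueness of
   the Jost solution is part of the definition, which makes the relations
   functional. *)
Definition is_scattering_a (q : R -> C) (lambda alpha : C) : Prop :=
  exists phi : R -> C * C,
    unique (is_jost_solution q lambda) phi /\
    filterlim (fun t : R => Cexp (Ci * lambda * t) * fst (phi t))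
      (Rbar_locally p_infty) (locally alpha).

Definition is_scattering_b (q : R -> C) (lambda beta : C) : Prop :=
  exists phi : R -> C * C,
    unique (is_jost_solution q lambda) phi /\
    filterlim (fun t : R => Cexp (- Ci * lambda * t) * snd (phi t))
      (Rbar_locally p_infty) (locally beta).

(* Only the values of [a] on the closed upper half plane are constrained, and
   they are determined by [q]. *)
Definition is_scattering_function_a (q : R -> C) (a : C -> C) : Prop :=
  forall lambda : C, (0 <= Im lambda)%R -> is_scattering_a q lambda (a lambda).

Definition is_eigenvalue (a : C -> C) (lambda : C) : Prop :=
  (0 < Im lambda)%R /\ a lambda = 0.

(* [is_derive] is here the complex derivative (over [C_AbsRing]).  The condition
   [a' <> 0] excludes the totalised division by zero. *)
Definition is_discrete_amplitude (q : R -> C) (a : C -> C) (lambda d : C) : Prop :=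
  is_eigenvalue a lambda /\
  exists a' b : C,
    is_derive (K := C_AbsRing) (V := C_NormedModule) a lambda a' /\
    a' <> 0 /\ is_scattering_b q lambda b /\ d = b / a'.

(* The family indexed by 1, ..., N is a function on [nat] used at 1, ..., N. *)
Definition Bcoef (N : nat) (lam Qd : nat -> C) (i : nat) : C :=
  - (Qd i / (lam i - Cconj (lam i))) *
  fold_right Cmult 1
    (map (fun k => (lam i - lam k) / (lam i - Cconj (lam k)))
       (filter (fun k => negb (Nat.eqb k i)) (seq 1 N))).

Definition v_init (N : nat) (lam Qd : nat -> C) (i : nat) (t : R) : C * C :=
  (1 * Cexp (- Ci * lam i * t), Bcoef N lam Qd i * Cexp (Ci * lam i * t)).

Definition sqnorm (psi : C * C) : C :=
  RtoC (Cmod (fst psi) ^ 2 + Cmod (snd psi) ^ 2)%R.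

(* One Darboux update of [v], attached to the spectral parameter [mu], by the
   eigenvector [psi] attached to [l]. *)
Definition darboux_step (l : C) (psi : C * C) (mu : C) (v : C * C) : C * C :=
  let p1 := fst psi in
  let p2 := snd psi in
  let dl := l - Cconj l in
  ((mu - Cconj l - dl * RtoC (Cmod p1 ^ 2)%R / sqnorm psi) * fst v
     - dl * Cconj p2 * p1 / sqnorm psi * snd v,
   - (dl * p2 * Cconj p1 / sqnorm psi) * fst v
     + (mu - l + dl * RtoC (Cmod p1 ^ 2)%R / sqnorm psi) * snd v).

(* [darboux_v N lam Qd i k] is v_k^(i); it is only meaningful for k > i. *)
Fixpoint darboux_v (N : nat) (lam Qd : nat -> C) (i k : nat) (t : R) : C * C :=
  match i with
  | O => v_init N lam Qd k t
  | S i' =>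
      darboux_step (lam i) (darboux_v N lam Qd i' i t)
        (lam k) (darboux_v N lam Qd i' k t)
  end.

(* [darboux_q N lam Qd i] is q^(i). *)
Fixpoint darboux_q (N : nat) (lam Qd : nat -> C) (i : nat) (t : R) : C :=
  match i with
  | O => 0
  | S i' =>
      let psi := darboux_v N lam Qd i' i t in
      darboux_q N lam Qd i' t
        - 2 * Ci * (lam i - Cconj (lam i))
          * (Cconj (snd psi) * fst psi / sqnorm psi)
  end.

(* Main.v *)
Require Import Defs.
From Stdlib Require Import Reals List Arith.
From Coquelicot Require Import Coquelicot.
From Stdlib Require Import Lra Lia FunctionalExtensionality.
Open Scope C_scope.

(** Each step [v |-> T v] of the recursion is a Darboux transformation: the
    matrix [T = mu - S], where [S] has eigenvalue [l] on [psi] and [Cconj l] on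
    the orthogonal complement of [psi], maps solutions for the potential
    [q^(i-1)] to solutions for [q^(i)], whatever the spectral parameter [mu]
    ([darboux_step_solution]).  So the composed matrix [T_N ... T_1]
    ([dressing]) carries the explicit solutions for [q = 0] to explicit
    solutions for [q^(N)], and all scattering data can be read off from them.

    Since [T] depends on [psi] only through its direction, and the direction of
    [psi] tends to the second axis at [-oo] and to the first axis at [+oo],
    [T] tends to [diag (mu - Cconj l, mu - l)] and to
    [diag (mu - l, mu - Cconj l)] respectively
    ([dressing_vlim_m_infty], [dressing_vlim_p_infty]).  Hence dressing
    [(e^{- j mu t}, 0)] and dividing by [prod (mu - Cconj lam_i)] gives the Jost
    solution, and the first component at [+oo] gives
    [a mu = prod (mu - lam_i) / (mu - Cconj lam_i)], whose zeros are the [lam_i],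
    all simple.

    For [b (lam_i)], the [i]-th step annihilates the vector [v_i] from which it
    is built, so that [T_N ... T_1] at [mu = lam_i] kills
    [(e^{- j lam_i t}, B_i e^{j lam_i t})] ([dressing_kernel]).  There the dressed
    [(e^{- j lam_i t}, 0)] equals the dressed [(0, - B_i e^{j lam_i t})], and the
    limit at [+oo] gives [b (lam_i) = - B_i] ([dressed_jost_b]).  The coefficient
    [B_i] is exactly [- Qd_i a' (lam_i)].

    Uniqueness of the Jost solution for [Im mu >= 0] is an energy argument
    ([zs_decaying_zero]). *)

(** * Limits and derivatives of complex-valued functions *)

Lemma Clim_components {T : Type} (F : (T -> Prop) -> Prop) {FF : Filter F}
  (f : T -> C) (l : C) :
  filterlim f F (locally l) <->
  filterlim (fun x => Re (f x)) F (locally (Re l)) /\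
  filterlim (fun x => Im (f x)) F (locally (Im l)).
Proof.
  split.
  - intros H. destruct l as [x y]. split.
    + apply (filterlim_comp _ _ _ f Re F (locally ((x, y) : C))); [exact H|].
      exact (@continuous_fst R_UniformSpace R_UniformSpace x y).
    + apply (filterlim_comp _ _ _ f Im F (locally ((x, y) : C))); [exact H|].
      exact (@continuous_snd R_UniformSpace R_UniformSpace x y).
  - intros [H1 H2].
    apply filterlim_locally. intros eps.
    assert (K1 := proj1 (filterlim_locally _ _) H1 eps).
    assert (K2 := proj1 (filterlim_locally _ _) H2 eps).
    generalize (filter_and _ _ K1 K2). apply filter_imp.
    intros t [A B]. split; assumption.
Qed.

Lemma Clim_plus {T : Type} (F : (T -> Prop) -> Prop) {FF : Filter F}
  (f g : T -> C) (l m : C) :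
  filterlim f F (locally l) -> filterlim g F (locally m) ->
  filterlim (fun x => f x + g x) F (locally (l + m)).
Proof.
  intros Hf Hg.
  exact (filterlim_comp_2 f g Cplus Hf Hg (@filterlim_plus _ C_R_NormedModule l m)).
Qed.

Lemma Clim_opp {T : Type} (F : (T -> Prop) -> Prop) {FF : Filter F}
  (f : T -> C) (l : C) :
  filterlim f F (locally l) -> filterlim (fun x => - f x) F (locally (- l)).
Proof.
  intros Hf.
  exact (filterlim_comp _ _ _ f Copp F _ _ Hf (@filterlim_opp _ C_R_NormedModule l)).
Qed.

Lemma Clim_minus {T : Type} (F : (T -> Prop) -> Prop) {FF : Filter F}
  (f g : T -> C) (l m : C) :
  filterlim f F (locally l) -> filterlim g F (locally m) ->
  filterlim (fun x => f x - g x) F (locally (l - m)).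
Proof. intros Hf Hg. exact (Clim_plus F _ _ _ _ Hf (Clim_opp F _ _ Hg)). Qed.

Lemma Rlim_mult {T : Type} (F : (T -> Prop) -> Prop) {FF : Filter F}
  (f g : T -> R) (l m : R) :
  filterlim f F (locally l) -> filterlim g F (locally m) ->
  filterlim (fun x => (f x * g x)%R) F (locally (l * m)%R).
Proof.
  intros Hf Hg.
  exact (filterlim_comp_2 f g Rmult Hf Hg (@filterlim_mult R_AbsRing l m)).
Qed.

Lemma Rlim_plus {T : Type} (F : (T -> Prop) -> Prop) {FF : Filter F}
  (f g : T -> R) (l m : R) :
  filterlim f F (locally l) -> filterlim g F (locally m) ->
  filterlim (fun x => (f x + g x)%R) F (locally (l + m)%R).
Proof.
  intros Hf Hg.
  exact (filterlim_comp_2 f g Rplus Hf Hg (@filterlim_plus _ R_NormedModule l m)).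
Qed.

Lemma Rlim_opp {T : Type} (F : (T -> Prop) -> Prop) {FF : Filter F}
  (f : T -> R) (l : R) :
  filterlim f F (locally l) -> filterlim (fun x => (- f x)%R) F (locally (- l)%R).
Proof.
  intros Hf.
  exact (filterlim_comp _ _ _ f Ropp F _ _ Hf (@filterlim_opp _ R_NormedModule l)).
Qed.

Lemma Rlim_inv {T : Type} (F : (T -> Prop) -> Prop) {FF : Filter F}
  (f : T -> R) (l : R) : l <> 0%R ->
  filterlim f F (locally l) -> filterlim (fun x => (/ f x)%R) F (locally (/ l)%R).
Proof.
  intros Hl Hf.
  apply (filterlim_comp _ _ _ f Rinv F (locally l)); [exact Hf|].
  refine (filterlim_Rbar_inv (Finite l) _). intros E; injection E; exact Hl.
Qed.

Lemma Clim_mult {T : Type} (F : (T -> Prop) -> Prop) {FF : Filter F}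
  (f g : T -> C) (l m : C) :
  filterlim f F (locally l) -> filterlim g F (locally m) ->
  filterlim (fun x => f x * g x) F (locally (l * m)).
Proof.
  intros Hf Hg.
  apply (Clim_components F) in Hf. apply (Clim_components F) in Hg.
  destruct Hf as [f1 f2]. destruct Hg as [g1 g2].
  apply (Clim_components F). split; simpl.
  - exact (Rlim_plus F _ _ _ _ (Rlim_mult F _ _ _ _ f1 g1)
             (Rlim_opp F _ _ (Rlim_mult F _ _ _ _ f2 g2))).
  - exact (Rlim_plus F _ _ _ _ (Rlim_mult F _ _ _ _ f1 g2)
             (Rlim_mult F _ _ _ _ f2 g1)).
Qed.

Lemma Clim_conj {T : Type} (F : (T -> Prop) -> Prop) {FF : Filter F}
  (f : T -> C) (l : C) :
  filterlim f F (locally l) ->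
  filterlim (fun x => Cconj (f x)) F (locally (Cconj l)).
Proof.
  intros Hf. apply (Clim_components F) in Hf. destruct Hf as [f1 f2].
  apply (Clim_components F). split; simpl; [exact f1|].
  apply (Rlim_opp F). exact f2.
Qed.

Lemma Cnorm2_neq0 (z : C) : z <> 0 -> (Re z ^ 2 + Im z ^ 2)%R <> 0%R.
Proof.
  intros Hz E. apply Hz. destruct z as [x y]; simpl in E.
  assert (x = 0%R) by nra. assert (y = 0%R) by nra. subst. reflexivity.
Qed.

Lemma Cconj_neq0 (z : C) : z <> 0 -> Cconj z <> 0.
Proof.
  intros Hz E. apply Hz. rewrite <- (Cconj_conj z), E.
  unfold Cconj, RtoC; simpl. f_equal; ring.
Qed.

Lemma Clim_inv {T : Type} (F : (T -> Prop) -> Prop) {FF : Filter F}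
  (f : T -> C) (l : C) : l <> 0 ->
  filterlim f F (locally l) -> filterlim (fun x => / f x) F (locally (/ l)).
Proof.
  intros Hl Hf. apply (Clim_components F) in Hf. destruct Hf as [f1 f2].
  assert (Hn : filterlim (fun x => (/ (Re (f x) ^ 2 + Im (f x) ^ 2))%R) F
                 (locally (/ (Re l ^ 2 + Im l ^ 2))%R)).
  { apply (Rlim_inv F); [apply Cnorm2_neq0; exact Hl|].
    apply (Rlim_plus F); repeat apply (Rlim_mult F); auto; apply filterlim_const. }
  apply (Clim_components F). split; unfold Cinv; simpl.
  - apply (Rlim_mult F); assumption.
  - apply (Rlim_mult F); [|exact Hn]. apply (Rlim_opp F); assumption.
Qed.

Lemma Clim_div {T : Type} (F : (T -> Prop) -> Prop) {FF : Filter F}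
  (f g : T -> C) (l m : C) : m <> 0 ->
  filterlim f F (locally l) -> filterlim g F (locally m) ->
  filterlim (fun x => f x / g x) F (locally (l / m)).
Proof. intros Hm Hf Hg. exact (Clim_mult F _ _ _ _ Hf (Clim_inv F _ _ Hm Hg)). Qed.

(** Derivatives in a real variable see C as the real normed module R * R, which
    is what makes them componentwise; the inferred structure is fixed here once. *)
Notation is_Cderive f t l :=
  (@is_derive R_AbsRing (prod_NormedModule R_AbsRing R_NormedModule R_NormedModule)
     f t (l : C)) (only parsing).

Lemma Cderive_components (f : R -> C) (t : R) (l : C) :
  is_Cderive f t l <->
  is_derive (fun s => Re (f s)) t (Re l) /\ is_derive (fun s => Im (f s)) t (Im l).
Proof.
  split.
  - intros H. split.
    + refine (filterdiff_comp' f (fun z : R * R => fst z) t _ (fun z : R * R => fst z) H _).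
      apply filterdiff_linear. apply is_linear_fst.
    + refine (filterdiff_comp' f (fun z : R * R => snd z) t _ (fun z : R * R => snd z) H _).
      apply filterdiff_linear. apply is_linear_snd.
  - intros [H1 H2].
    apply (is_derive_ext (fun s => (Re (f s), Im (f s)) : R * R)).
    { intros s. symmetry. apply surjective_pairing. }
    refine (@filterdiff_comp'_2 R_AbsRing R_NormedModule R_NormedModule R_NormedModule
      (prod_NormedModule R_AbsRing R_NormedModule R_NormedModule)
      (fun s => Re (f s)) (fun s => Im (f s)) (fun x y => (x, y)) t
      (fun s => scal s (Re l)) (fun s => scal s (Im l)) (fun x y => (x, y)) H1 H2 _).
    set (RR := prod_NormedModule R_AbsRing R_NormedModule R_NormedModule).
    assert (Hid : forall (h : RR -> RR) (F : (RR -> Prop) -> Prop),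
              h = (fun z => z) -> filterdiff h F h).
    { intros h F ->. apply filterdiff_id. }
    apply Hid. apply functional_extensionality. intros [x y]. reflexivity.
Qed.

Lemma Cderive_eq (f : R -> C) (t : R) (l m : C) :
  l = m -> is_Cderive f t l -> is_Cderive f t m.
Proof. intros E H. rewrite <- E. exact H. Qed.

Lemma Rderive_eq (f : R -> R) (t l m : R) :
  l = m -> is_derive f t l -> is_derive f t m.
Proof. intros E H. rewrite <- E. exact H. Qed.

Lemma Cderive_const (c : C) (t : R) : is_Cderive (fun _ => c) t 0.
Proof. apply Cderive_components. split; apply (@is_derive_const R_AbsRing R_NormedModule). Qed.

Lemma Cderive_plus (f g : R -> C) (t : R) (l m : C) :
  is_Cderive f t l -> is_Cderive g t m -> is_Cderive (fun s => f s + g s) t (l + m).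
Proof. intros Hf Hg. exact (is_derive_plus _ _ _ _ _ Hf Hg). Qed.

Lemma Cderive_minus (f g : R -> C) (t : R) (l m : C) :
  is_Cderive f t l -> is_Cderive g t m -> is_Cderive (fun s => f s - g s) t (l - m).
Proof. intros Hf Hg. exact (is_derive_minus _ _ _ _ _ Hf Hg). Qed.

Lemma Cderive_mult (f g : R -> C) (t : R) (l m : C) :
  is_Cderive f t l -> is_Cderive g t m ->
  is_Cderive (fun s => f s * g s) t (l * g t + f t * m).
Proof.
  intros Hf Hg.
  apply Cderive_components in Hf. apply Cderive_components in Hg.
  destruct Hf as [f1 f2]. destruct Hg as [g1 g2].
  apply Cderive_components. split.
  - eapply Rderive_eq; [|exact (is_derive_minus _ _ _ _ _
      (Derive.is_derive_mult _ _ _ _ _ f1 g1) (Derive.is_derive_mult _ _ _ _ _ f2 g2))].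
    unfold minus, plus, opp, Re, Im; simpl. ring.
  - eapply Rderive_eq; [|exact (is_derive_plus _ _ _ _ _
      (Derive.is_derive_mult _ _ _ _ _ f1 g2) (Derive.is_derive_mult _ _ _ _ _ f2 g1))].
    unfold plus, Re, Im; simpl. ring.
Qed.

Lemma Cderive_conj (f : R -> C) (t : R) (l : C) :
  is_Cderive f t l -> is_Cderive (fun s => Cconj (f s)) t (Cconj l).
Proof.
  intros Hf. apply Cderive_components in Hf. destruct Hf as [f1 f2].
  apply Cderive_components. split; [exact f1|]. exact (is_derive_opp _ _ _ f2).
Qed.

Lemma Cderive_inv (f : R -> C) (t : R) (l : C) : f t <> 0 ->
  is_Cderive f t l -> is_Cderive (fun s => / f s) t (- l / (f t * f t)).
Proof.
  intros Ht Hf. apply Cderive_components in Hf. destruct Hf as [f1 f2].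
  assert (Hn := Cnorm2_neq0 _ Ht).
  assert (D := is_derive_plus _ _ _ _ _
    (Derive.is_derive_mult _ _ _ _ _ f1 f1) (Derive.is_derive_mult _ _ _ _ _ f2 f2)).
  assert (Hn' : plus (Re (f t) * Re (f t))%R (Im (f t) * Im (f t))%R <> 0%R).
  { intros E; apply Hn. rewrite <- E. unfold plus, Re, Im; simpl. ring. }
  assert (D1 := is_derive_div _ _ _ _ _ f1 D Hn').
  assert (D2 := is_derive_opp _ _ _ (is_derive_div _ _ _ _ _ f2 D Hn')).
  (* Multiply twice by the conjugate to get a real denominator. *)
  assert (E : (- l / (f t * f t)) =
    - l * Cconj (f t) * Cconj (f t) / RtoC ((Re (f t) ^ 2 + Im (f t) ^ 2) ^ 2)%R).
  { assert (N : RtoC (Re (f t) ^ 2 + Im (f t) ^ 2)%R = f t * Cconj (f t)).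
    { destruct (f t) as [x y]. unfold RtoC, Cmult, Cconj; simpl. f_equal; ring. }
    assert (Nc := Cconj_neq0 _ Ht).
    rewrite RtoC_pow, N. field. auto. }
  rewrite E. apply Cderive_components. split.
  - refine (is_derive_ext _ _ _ _ _ (Rderive_eq _ _ _ _ _ D1)).
    + intros s. unfold plus, Re, Im; simpl. unfold Rdiv; f_equal; f_equal; ring.
    + unfold plus, Re, Im, Cdiv, Cinv, Cmult, Copp, Cconj, RtoC; simpl.
      destruct (f t) as [x y], l as [u v]; simpl in *. field.
      exact Hn'.
  - refine (is_derive_ext _ _ _ _ _ (Rderive_eq _ _ _ _ _ D2)).
    + intros s. unfold plus, opp, Re, Im; simpl. unfold Rdiv.
      rewrite <- Ropp_mult_distr_l_reverse. f_equal; f_equal; ring.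
    + unfold plus, opp, Re, Im, Cdiv, Cinv, Cmult, Copp, Cconj, RtoC; simpl.
      destruct (f t) as [x y], l as [u v]; simpl in *. field.
      exact Hn'.
Qed.

Lemma Cderive_div (f g : R -> C) (t : R) (l m : C) : g t <> 0 ->
  is_Cderive f t l -> is_Cderive g t m ->
  is_Cderive (fun s => f s / g s) t ((l * g t - f t * m) / (g t * g t)).
Proof.
  intros H0 Hf Hg.
  eapply Cderive_eq; [|exact (Cderive_mult _ _ _ _ _ Hf (Cderive_inv _ _ _ H0 Hg))].
  cbv beta. field. exact H0.
Qed.

Lemma Cderive_Cexp (c : C) (t : R) :
  is_Cderive (fun s => Cexp (c * s)) t (c * Cexp (c * t)).
Proof.
  destruct c as [x y]. apply Cderive_components.
  unfold Cexp, Cmult, RtoC, Re, Im, Rminus; simpl. split; auto_derive; auto; simpl; ring.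
Qed.

Lemma Cmult_eq_0_r (a b : C) : a <> 0 -> a * b = 0 -> b = 0.
Proof.
  intros Ha E. replace b with (/ a * (a * b)) by (field; exact Ha).
  rewrite E. ring.
Qed.

Lemma RtoC_Cmod2 (z : C) : RtoC (Cmod z ^ 2)%R = z * Cconj z.
Proof. rewrite RtoC_pow, <- Cmod2_conj, RtoC_pow. reflexivity. Qed.

Lemma sqnormE (psi : C * C) :
  sqnorm psi = fst psi * Cconj (fst psi) + snd psi * Cconj (snd psi).
Proof. unfold sqnorm. rewrite RtoC_plus, !RtoC_Cmod2. reflexivity. Qed.

Lemma sqnorm_neq0 (psi : C * C) : psi <> (RtoC 0, RtoC 0) -> sqnorm psi <> 0.
Proof.
  intros H E. apply H. destruct psi as [p1 p2].
  unfold sqnorm in E; simpl in E. apply RtoC_inj in E.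
  assert (H1 := Cmod_ge_0 p1). assert (H2 := Cmod_ge_0 p2).
  f_equal; apply Cmod_eq_0; nra.
Qed.

(** * One Darboux step *)

Definition vadd (u v : C * C) : C * C := (fst u + fst v, snd u + snd v).
Definition vscal (c : C) (v : C * C) : C * C := (c * fst v, c * snd v).

Lemma darboux_step_vadd (l : C) (psi : C * C) (mu : C) (u v : C * C) :
  darboux_step l psi mu (vadd u v) =
  vadd (darboux_step l psi mu u) (darboux_step l psi mu v).
Proof. unfold darboux_step, vadd; cbn [fst snd]. f_equal; unfold Cdiv; ring. Qed.

Lemma darboux_step_vscal (l : C) (psi : C * C) (mu c : C) (v : C * C) :
  darboux_step l psi mu (vscal c v) = vscal c (darboux_step l psi mu v).
Proof. unfold darboux_step, vscal; cbn [fst snd]. f_equal; unfold Cdiv; ring. Qed.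

(** The coefficient of the orthogonal projection of [v] on the line of [psi]. *)
Definition projcoef (psi v : C * C) : C :=
  (Cconj (fst psi) * fst v + Cconj (snd psi) * snd v) / sqnorm psi.

(** With [P] the orthogonal projector on [psi], the step is
    [(mu - Cconj l) - (l - Cconj l) P].  In this form it involves the conjugate of
    [psi] only through one scalar, which keeps the computations below short. *)
Lemma darboux_step_proj (l : C) (psi : C * C) (mu : C) (v : C * C) :
  psi <> (RtoC 0, RtoC 0) ->
  darboux_step l psi mu v =
  ((mu - Cconj l) * fst v - (l - Cconj l) * projcoef psi v * fst psi,
   (mu - Cconj l) * snd v - (l - Cconj l) * projcoef psi v * snd psi).
Proof.
  intros H. apply sqnorm_neq0 in H. rewrite sqnormE in H.
  unfold darboux_step, projcoef. rewrite RtoC_Cmod2, sqnormE.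
  f_equal; field; exact H.
Qed.

Lemma darboux_step_kernel (l : C) (psi : C * C) :
  psi <> (RtoC 0, RtoC 0) -> darboux_step l psi l psi = (RtoC 0, RtoC 0).
Proof.
  intros H. rewrite darboux_step_proj by exact H.
  apply sqnorm_neq0 in H. rewrite sqnormE in H.
  unfold projcoef. rewrite sqnormE. f_equal; field; exact H.
Qed.

(** The matrix of the step has determinant [(mu - l) (mu - Cconj l)].  The proof
    first pairs the image with [psi], on which the step acts by [mu - l]. *)
Lemma darboux_step_injective (l : C) (psi : C * C) (mu : C) (v : C * C) :
  psi <> (RtoC 0, RtoC 0) -> mu <> l -> mu <> Cconj l ->
  v <> (RtoC 0, RtoC 0) -> darboux_step l psi mu v <> (RtoC 0, RtoC 0).
Proof.
  intros H Hl Hl' Hv E. apply Hv. rewrite darboux_step_proj in E by exact H.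
  apply sqnorm_neq0 in H.
  apply pair_equal_spec in E. destruct E as [E1 E2].
  assert (Hc : projcoef psi v = 0).
  { apply (Cmult_eq_0_r (mu - l)); [apply Cminus_eq_contra; exact Hl|].
    transitivity ((Cconj (fst psi) * ((mu - Cconj l) * fst v - (l - Cconj l) * projcoef psi v * fst psi)
      + Cconj (snd psi) * ((mu - Cconj l) * snd v - (l - Cconj l) * projcoef psi v * snd psi))
       / sqnorm psi).
    - unfold projcoef. rewrite sqnormE in *. field. exact H.
    - rewrite E1, E2. field. exact H. }
  rewrite Hc in E1, E2.
  destruct v as [v1 v2]; cbn [fst snd] in *.
  f_equal; apply (Cmult_eq_0_r (mu - Cconj l)); try (apply Cminus_eq_contra; exact Hl');
    [rewrite <- E1 | rewrite <- E2]; ring.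
Qed.

Lemma darboux_step_direction (l : C) (c : C) (psi : C * C) (mu : C) (v : C * C) :
  c <> 0 -> psi <> (RtoC 0, RtoC 0) ->
  darboux_step l (vscal c psi) mu v = darboux_step l psi mu v.
Proof.
  intros Hc H. apply sqnorm_neq0 in H. rewrite sqnormE in H.
  assert (Hc' := Cconj_neq0 c Hc).
  unfold darboux_step, vscal; cbn [fst snd]. rewrite !RtoC_Cmod2, !sqnormE; cbn [fst snd].
  rewrite !Cmult_conj.
  assert (H' : c * fst psi * (Cconj c * Cconj (fst psi)) + c * snd psi * (Cconj c * Cconj (snd psi)) <> 0).
  { replace (c * fst psi * (Cconj c * Cconj (fst psi)) + c * snd psi * (Cconj c * Cconj (snd psi)))
      with (c * Cconj c * (fst psi * Cconj (fst psi) + snd psi * Cconj (snd psi))) by ring.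
    repeat apply Cmult_neq_0; assumption. }
  f_equal; field; auto.
Qed.

Definition vlim (F : (R -> Prop) -> Prop) (u : R -> C * C) (l : C * C) : Prop :=
  filterlim (fun t => fst (u t)) F (locally (fst l)) /\
  filterlim (fun t => snd (u t)) F (locally (snd l)).

(** The step sees only the direction of [psi], so [psi] may be rescaled by any
    nonvanishing [w] before passing to the limit: this is how an exponentially
    growing or decaying [psi] gets a limit [p]. *)
Lemma darboux_step_vlim (F : (R -> Prop) -> Prop) {FF : Filter F} (l mu : C)
  (w : R -> C) (psi v : R -> C * C) (p z : C * C) :
  (forall t, w t <> 0) -> (forall t, psi t <> (RtoC 0, RtoC 0)) ->
  p <> (RtoC 0, RtoC 0) ->
  vlim F (fun t => vscal (w t) (psi t)) p -> vlim F v z ->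
  vlim F (fun t => darboux_step l (psi t) mu (v t)) (darboux_step l p mu z).
Proof.
  intros Hw Hpsi Hp [P1 P2] [V1 V2].
  assert (Hsq := sqnorm_neq0 p Hp).
  assert (Heq : forall t, darboux_step l (vscal (w t) (psi t)) mu (v t) =
                          darboux_step l (psi t) mu (v t))
    by (intros; apply darboux_step_direction; auto).
  assert (Hn : filterlim (fun t => sqnorm (vscal (w t) (psi t))) F (locally (sqnorm p))).
  { rewrite sqnormE.
    apply (filterlim_ext (fun t => fst (vscal (w t) (psi t)) * Cconj (fst (vscal (w t) (psi t)))
       + snd (vscal (w t) (psi t)) * Cconj (snd (vscal (w t) (psi t))))).
    { intros t. symmetry. apply sqnormE. }
    exact (Clim_plus F _ _ _ _ (Clim_mult F _ _ _ _ P1 (Clim_conj F _ _ P1))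
      (Clim_mult F _ _ _ _ P2 (Clim_conj F _ _ P2))). }
  assert (Hc : filterlim (fun t => RtoC (Cmod (fst (vscal (w t) (psi t))) ^ 2)%R) F
     (locally (RtoC (Cmod (fst p) ^ 2)%R))).
  { rewrite RtoC_Cmod2.
    apply (filterlim_ext (fun t => fst (vscal (w t) (psi t)) * Cconj (fst (vscal (w t) (psi t))))).
    { intros t. symmetry. apply RtoC_Cmod2. }
    exact (Clim_mult F _ _ _ _ P1 (Clim_conj F _ _ P1)). }
  assert (K : forall c : C, filterlim (fun _ : R => c) F (locally c))
    by (intros; apply filterlim_const).
  split.
  - apply (filterlim_ext (fun t => fst (darboux_step l (vscal (w t) (psi t)) mu (v t)))).
    { intros t. rewrite Heq. reflexivity. }
    unfold darboux_step at 2. cbv zeta.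
    exact (Clim_minus F _ _ _ _
      (Clim_mult F _ _ _ _ (Clim_minus F _ _ _ _ (K (mu - Cconj l))
         (Clim_div F _ _ _ _ Hsq (Clim_mult F _ _ _ _ (K (l - Cconj l)) Hc) Hn)) V1)
      (Clim_mult F _ _ _ _ (Clim_div F _ _ _ _ Hsq (Clim_mult F _ _ _ _
         (Clim_mult F _ _ _ _ (K (l - Cconj l)) (Clim_conj F _ _ P2)) P1) Hn) V2)).
  - apply (filterlim_ext (fun t => snd (darboux_step l (vscal (w t) (psi t)) mu (v t)))).
    { intros t. rewrite Heq. reflexivity. }
    unfold darboux_step at 2. cbv zeta.
    exact (Clim_plus F _ _ _ _
      (Clim_mult F _ _ _ _ (Clim_opp F _ _ (Clim_div F _ _ _ _ Hsq (Clim_mult F _ _ _ _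
         (Clim_mult F _ _ _ _ (K (l - Cconj l)) P2) (Clim_conj F _ _ P1)) Hn)) V1)
      (Clim_mult F _ _ _ _ (Clim_plus F _ _ _ _ (K (mu - l))
         (Clim_div F _ _ _ _ Hsq (Clim_mult F _ _ _ _ (K (l - Cconj l)) Hc) Hn)) V2)).
Qed.

Lemma Cconj_0 : Cconj 0 = 0.
Proof. unfold Cconj, RtoC; simpl. f_equal; ring. Qed.

Lemma darboux_step_axis1 (l mu c : C) (z : C * C) : c <> 0 ->
  darboux_step l (c, RtoC 0) mu z = ((mu - l) * fst z, (mu - Cconj l) * snd z).
Proof.
  intros Hc.
  rewrite darboux_step_proj by (intros E; apply pair_equal_spec in E; apply Hc, E).
  assert (Hc' := Cconj_neq0 c Hc).
  unfold projcoef. rewrite sqnormE; cbn [fst snd]. rewrite Cconj_0.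
  f_equal; field; auto.
Qed.

Lemma darboux_step_axis2 (l mu c : C) (z : C * C) : c <> 0 ->
  darboux_step l (RtoC 0, c) mu z = ((mu - Cconj l) * fst z, (mu - l) * snd z).
Proof.
  intros Hc.
  rewrite darboux_step_proj by (intros E; apply pair_equal_spec in E; apply Hc, E).
  assert (Hc' := Cconj_neq0 c Hc).
  unfold projcoef. rewrite sqnormE; cbn [fst snd]. rewrite Cconj_0.
  f_equal; field; auto.
Qed.

(** The Zakharov-Shabat system, the differential equation of a Jost solution. *)
Definition zs_solution (q : R -> C) (mu : C) (v : R -> C * C) : Prop :=
  forall t : R,
    is_Cderive (fun s => fst (v s)) t (- Ci * mu * fst (v t) + q t * snd (v t)) /\
    is_Cderive (fun s => snd (v s)) t
      (- Cconj (q t) * fst (v t) + Ci * mu * snd (v t)).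

Lemma Cconj_Ci : Cconj Ci = - Ci.
Proof. unfold Cconj, Ci, Copp; simpl. f_equal; ring. Qed.

Lemma Cconj_RtoC (x : R) : Cconj (RtoC x) = RtoC x.
Proof. unfold Cconj, RtoC; simpl. f_equal; ring. Qed.

(** The Darboux theorem: with [J = diag (- j, j)] and [Q] the off-diagonal matrix
    of the potential, [mu - S] intertwines [mu J + Q] and [mu J + Q + [J, S]],
    because the eigenvectors of [S] solve the system at [l] and at [Cconj l].
    The upper right entry of [[J, S]] is the increment of the potential. *)
Lemma darboux_step_solution (q : R -> C) (l mu : C) (psi v : R -> C * C) :
  (forall t, psi t <> (RtoC 0, RtoC 0)) ->
  zs_solution q l psi -> zs_solution q mu v ->
  zs_solution
    (fun t => q t - 2 * Ci * (l - Cconj l)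
                * (Cconj (snd (psi t)) * fst (psi t) / sqnorm (psi t)))
    mu (fun t => darboux_step l (psi t) mu (v t)).
Proof.
  intros Hpsi Hl Hmu t.
  destruct (Hl t) as [P1 P2]. destruct (Hmu t) as [V1 V2].
  assert (P1' := Cderive_conj _ _ _ P1). assert (P2' := Cderive_conj _ _ _ P2).
  assert (Hn := sqnorm_neq0 _ (Hpsi t)). rewrite sqnormE in Hn.
  assert (Hn' : Cconj (fst (psi t)) * fst (psi t) + Cconj (snd (psi t)) * snd (psi t) <> 0)
    by (intros E; apply Hn; rewrite <- E; ring).
  (* The systems for psi and v are linked by the fact that Q is
     anti-Hermitian, so the potential disappears from this derivative. *)
  assert (Dr : is_Cderive (fun s => projcoef (psi s) (v s)) t
    ((mu - Cconj l) * Ci * (Cconj (snd (psi t)) * snd (v t) - Cconj (fst (psi t)) * fst (v t)) / sqnorm (psi t)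
     - projcoef (psi t) (v t) * ((l - Cconj l) * Ci * (Cconj (snd (psi t)) * snd (psi t) - Cconj (fst (psi t)) * fst (psi t))) / sqnorm (psi t))).
  { refine (is_derive_ext _ _ _ _ _ (Cderive_eq _ _ _ _ _ (Cderive_div
      (fun s => Cconj (fst (psi s)) * fst (v s) + Cconj (snd (psi s)) * snd (v s))
      (fun s => fst (psi s) * Cconj (fst (psi s)) + snd (psi s) * Cconj (snd (psi s)))
      t _ _ Hn
      (Cderive_plus _ _ _ _ _ (Cderive_mult _ _ _ _ _ P1' V1) (Cderive_mult _ _ _ _ _ P2' V2))
      (Cderive_plus _ _ _ _ _ (Cderive_mult _ _ _ _ _ P1 P1') (Cderive_mult _ _ _ _ _ P2 P2'))))).
    - intros s. unfold projcoef. rewrite sqnormE. reflexivity.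
    - unfold projcoef. rewrite !sqnormE.
      rewrite !Cplus_conj, !Cmult_conj, !Copp_conj, !Cconj_conj, !Cconj_Ci.
      field. exact Hn. }
  cbn beta.
  split.
  - refine (is_derive_ext _ _ _ _ _ (Cderive_eq _ _ _ _ _ (Cderive_minus _ _ _ _ _
      (Cderive_mult _ _ _ _ _ (Cderive_const (mu - Cconj l) t) V1)
      (Cderive_mult _ _ _ _ _ (Cderive_mult _ _ _ _ _ (Cderive_const (l - Cconj l) t) Dr) P1)))).
    + intros s. rewrite darboux_step_proj by apply Hpsi. reflexivity.
    + rewrite darboux_step_proj by apply Hpsi. cbn [fst snd].
      unfold projcoef. rewrite !sqnormE. field. exact Hn.
  - refine (is_derive_ext _ _ _ _ _ (Cderive_eq _ _ _ _ _ (Cderive_minus _ _ _ _ _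
      (Cderive_mult _ _ _ _ _ (Cderive_const (mu - Cconj l) t) V2)
      (Cderive_mult _ _ _ _ _ (Cderive_mult _ _ _ _ _ (Cderive_const (l - Cconj l) t) Dr) P2)))).
    + intros s. rewrite darboux_step_proj by apply Hpsi. reflexivity.
    + rewrite darboux_step_proj by apply Hpsi. cbn [fst snd].
      unfold projcoef. rewrite !sqnormE.
      unfold Cdiv.
      rewrite !Cminus_conj, !Cmult_conj, (Cinv_conj _ Hn), !Cplus_conj, !Cmult_conj, !Cminus_conj, !Cconj_conj, !Cconj_Ci, !Cconj_RtoC.
      field. auto.
Qed.

(** * The complex exponential *)

Lemma Cexp_plus (x y : C) : Cexp (x + y) = Cexp x * Cexp y.
Proof.
  unfold Cexp, Cplus, Cmult, Re, Im; simpl.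
  rewrite exp_plus, cos_plus, sin_plus. f_equal; ring.
Qed.

Lemma Cexp_0 : Cexp 0 = 1.
Proof.
  unfold Cexp, RtoC, Re, Im; simpl. rewrite exp_0, cos_0, sin_0. f_equal; ring.
Qed.

Lemma Cexp_opp_l (x : C) : Cexp (- x) * Cexp x = 1.
Proof. rewrite <- Cexp_plus, <- Cexp_0. f_equal. ring. Qed.

Lemma Cexp_neq0 (x : C) : Cexp x <> 0.
Proof.
  intros E. apply C1_nz. rewrite <- (Cexp_opp_l x), E. ring.
Qed.

Lemma Cexp_lim_0 (c : C) (F : (R -> Prop) -> Prop) {FF : Filter F} :
  filterlim (fun t => (Re c * t)%R) F (Rbar_locally m_infty) ->
  filterlim (fun t : R => Cexp (c * t)) F (locally (RtoC 0)).
Proof.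
  intros H.
  assert (L : filterlim (fun t => exp (Re c * t)) F (locally 0%R)).
  { exact (filterlim_comp _ _ _ _ exp F _ _ H is_lim_exp_m). }
  assert (B : forall f : R -> R, (forall x, (-1 <= f x <= 1)%R) ->
    filterlim (fun t : R => (exp (Re c * t) * f (Im c * t))%R) F (locally 0%R)).
  { intros f Hf. apply filterlim_locally. intros eps.
    assert (K := proj1 (filterlim_locally _ _) L eps). revert K.
    apply filter_imp. intros t Ht.
    unfold ball in *; simpl in *. unfold AbsRing_ball, abs, minus, plus, opp in *; simpl in *.
    assert (E := exp_pos (Re c * t)). assert (F1 := Hf (Im c * t)%R).
    apply Rabs_def2 in Ht. apply Rabs_def1; nra. }
  assert (E : forall t : R, Cexp (c * t) =
    (exp (Re c * t) * cos (Im c * t), exp (Re c * t) * sin (Im c * t))%R).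
  { intros t. unfold Cexp. destruct c as [x y]. unfold Cmult, RtoC, Re, Im; simpl.
    f_equal; f_equal; f_equal; ring. }
  apply (Clim_components F). split.
  - apply (filterlim_ext (fun t : R => (exp (Re c * t) * cos (Im c * t))%R)).
    + intros t. rewrite E. reflexivity.
    + apply B. exact COS_bound.
  - apply (filterlim_ext (fun t : R => (exp (Re c * t) * sin (Im c * t))%R)).
    + intros t. rewrite E. reflexivity.
    + apply B. exact SIN_bound.
Qed.

Lemma Cexp_lim_p_infty (c : C) : (Re c < 0)%R ->
  filterlim (fun t : R => Cexp (c * t)) (Rbar_locally p_infty) (locally (RtoC 0)).
Proof.
  intros Hc. apply Cexp_lim_0; [typeclasses eauto|].
  assert (H := filterlim_Rbar_mult_l (Re c) p_infty).
  rewrite Rbar_mult_comm in H.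
  rewrite (is_Rbar_mult_unique _ _ _ (is_Rbar_mult_p_infty_neg (Finite (Re c)) Hc)) in H.
  exact H.
Qed.

Lemma Cexp_lim_m_infty (c : C) : (0 < Re c)%R ->
  filterlim (fun t : R => Cexp (c * t)) (Rbar_locally m_infty) (locally (RtoC 0)).
Proof.
  intros Hc. apply Cexp_lim_0; [typeclasses eauto|].
  assert (H := filterlim_Rbar_mult_l (Re c) m_infty).
  rewrite Rbar_mult_comm in H.
  rewrite (is_Rbar_mult_unique _ _ _ (is_Rbar_mult_m_infty_pos (Finite (Re c)) Hc)) in H.
  exact H.
Qed.

(** * Finite products *)

Definition Cprod (f : nat -> C) (l : list nat) : C := fold_right Cmult 1 (map f l).

Lemma Cprod_app (f : nat -> C) (l l' : list nat) :
  Cprod f (l ++ l') = Cprod f l * Cprod f l'.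
Proof.
  unfold Cprod. induction l as [|k l IH]; simpl; [ring|]. rewrite IH. ring.
Qed.

Lemma Cprod_seq_S (f : nat -> C) (n : nat) :
  Cprod f (seq 1 (S n)) = f (S n) * Cprod f (seq 1 n).
Proof. rewrite seq_S, Cprod_app. unfold Cprod at 2; simpl. ring. Qed.

Lemma Cprod_eq_0 (f : nat -> C) (l : list nat) :
  Cprod f l = 0 -> exists k, In k l /\ f k = 0.
Proof.
  induction l as [|k l IH]; intros E.
  - exfalso. exact (C1_nz E).
  - destruct (Ceq_dec (f k) 0) as [Hk|Hk]; [exists k; split; [left|]; auto|].
    destruct IH as [j [Hj Ej]]; [exact (Cmult_eq_0_r _ _ Hk E)|].
    exists j. split; [right|]; assumption.
Qed.

Lemma Cprod_neq0 (f : nat -> C) (l : list nat) :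
  (forall k, In k l -> f k <> 0) -> Cprod f l <> 0.
Proof. intros H E. apply Cprod_eq_0 in E. destruct E as [k [Hk Ek]]. exact (H k Hk Ek). Qed.

Lemma Cprod_div (f g : nat -> C) (l : list nat) :
  (forall k, In k l -> g k <> 0) ->
  Cprod (fun k => f k / g k) l = Cprod f l / Cprod g l.
Proof.
  induction l as [|k l IH]; intros H.
  - unfold Cprod; simpl. field.
  - assert (Hk : g k <> 0) by (apply H; left; reflexivity).
    assert (Hl : forall j, In j l -> g j <> 0) by (intros j Hj; apply H; right; exact Hj).
    assert (Hp := Cprod_neq0 g l Hl). specialize (IH Hl).
    unfold Cprod in *; cbn [map fold_right]. rewrite IH. field. auto.
Qed.

Definition others (i : nat) (l : list nat) : list nat :=
  filter (fun k => negb (Nat.eqb k i)) l.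

Lemma others_notin (i : nat) (l : list nat) : ~ In i l -> others i l = l.
Proof.
  unfold others. induction l as [|k l IH]; intros H; simpl; [reflexivity|].
  destruct (Nat.eqb_spec k i) as [->|Hk]; simpl.
  - exfalso. apply H. left. reflexivity.
  - f_equal. apply IH. intros Hi. apply H. right. exact Hi.
Qed.

Lemma Cprod_others (f : nat -> C) (i : nat) (l : list nat) :
  NoDup l -> In i l -> Cprod f l = f i * Cprod f (others i l).
Proof.
  induction l as [|k l IH]; intros Hd Hi; [destruct Hi|].
  inversion Hd as [|? ? Hk Hl]; subst.
  unfold others; simpl. fold (others i l). destruct (Nat.eqb_spec k i) as [->|Hki]; cbn [negb].
  - rewrite (others_notin i l Hk). reflexivity.
  - destruct Hi as [E|Hi]; [contradiction|].
    unfold Cprod in *; cbn [map fold_right]. rewrite (IH Hl Hi). ring.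
Qed.

Lemma Clim_Cprod {T : Type} (F : (T -> Prop) -> Prop) {FF : Filter F}
  (f : T -> nat -> C) (m : nat -> C) (l : list nat) :
  (forall k, filterlim (fun x => f x k) F (locally (m k))) ->
  filterlim (fun x => Cprod (f x) l) F (locally (Cprod m l)).
Proof.
  intros H. induction l as [|k l IH].
  - unfold Cprod; simpl. apply filterlim_const.
  - exact (Clim_mult F _ _ _ _ (H k) IH).
Qed.

(** The difference quotient of [f] at its zero [z] is [g] itself, whose
    limit is given by continuity. *)
Lemma Cderive_simple_zero (f g : C -> C) (z : C) :
  (forall x, f x = (x - z) * g x) ->
  filterlim g (locally z) (locally (g z)) ->
  is_derive (K := C_AbsRing) (V := C_NormedModule) f z (g z).
Proof.
  intros Hf Hg. split.
  - apply (@is_linear_scal_l C_AbsRing C_NormedModule).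
  - intros x Hx.
    apply (@is_filter_lim_locally_unique C_AbsRing (AbsRing_NormedModule C_AbsRing)) in Hx.
    subst x. intros eps.
    assert (Hg' : locally (T := C_UniformSpace) z (fun y => Cmod (g y - g z) < eps)%R).
    { apply (Hg (fun w => Cmod (w - g z) < eps)%R). apply locally_C.
      exists eps. intros w Hw. exact Hw. }
    apply locally_C in Hg'. revert Hg'. apply filter_imp. intros y Hy.
    change (Cmod (f y - f z - (y - z) * g z) <= eps * Cmod (y - z))%R.
    rewrite !Hf.
    replace ((y - z) * g y - (z - z) * g z - (y - z) * g z) with ((g y - g z) * (y - z)) by ring.
    rewrite Cmod_mult. apply Rmult_le_compat_r; [apply Cmod_ge_0|]. lra.
Qed.

(** * Uniqueness of the Jost solution *)

(** For [u = e^{j lambda t} d] the energy [|u_1|^2 + |u_2|^2] has derivative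
    [- 4 Im lambda |u_2|^2 <= 0] and tends to [0] at [-oo]; being nonnegative, it
    vanishes identically.  The potential cancels since its matrix is
    anti-Hermitian. *)
Lemma zs_decaying_zero (q : R -> C) (lambda : C) (d : R -> C * C) :
  (0 <= Im lambda)%R -> zs_solution q lambda d ->
  vlim (Rbar_locally m_infty) (fun t => vscal (Cexp (Ci * lambda * t)) (d t))
    (RtoC 0, RtoC 0) ->
  forall t, d t = (RtoC 0, RtoC 0).
Proof.
  intros Him Hd [L1 L2].
  set (u1 := fun t : R => Cexp (Ci * lambda * t) * fst (d t)).
  set (u2 := fun t : R => Cexp (Ci * lambda * t) * snd (d t)).
  set (g := fun t : R => Re (u1 t * Cconj (u1 t) + u2 t * Cconj (u2 t))).
  assert (D : forall t, is_derive g t (- 4 * Im lambda * Cmod (u2 t) ^ 2)%R).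
  { intros t. destruct (Hd t) as [D1 D2].
    assert (E := Cderive_Cexp (Ci * lambda) t).
    assert (U1 : is_Cderive u1 t (q t * u2 t)).
    { refine (Cderive_eq _ _ _ _ _ (Cderive_mult _ _ _ _ _ E D1)). unfold u2. ring. }
    assert (U2 : is_Cderive u2 t (2 * Ci * lambda * u2 t - Cconj (q t) * u1 t)).
    { refine (Cderive_eq _ _ _ _ _ (Cderive_mult _ _ _ _ _ E D2)). unfold u1, u2. ring. }
    assert (G := Cderive_plus _ _ _ _ _
      (Cderive_mult _ _ _ _ _ U1 (Cderive_conj _ _ _ U1))
      (Cderive_mult _ _ _ _ _ U2 (Cderive_conj _ _ _ U2))).
    apply Cderive_components in G.
    refine (Rderive_eq _ _ _ _ _ (proj1 G)).
    fold (u1 t) (u2 t).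
    replace (- 4 * Im lambda * Cmod (u2 t) ^ 2)%R
      with (Re (- (RtoC 4) * Im lambda * (u2 t * Cconj (u2 t)))).
    - f_equal. rewrite Cminus_conj, !Cmult_conj, Cconj_conj, Cconj_Ci, Cconj_RtoC.
      assert (EI : RtoC (Im lambda) = - Ci * (lambda - Cconj lambda) / 2).
      { rewrite im_alt'. replace (- Ci * (2 * Ci * Im lambda) / 2) with (- (Ci * Ci) * Im lambda) by field.
        assert (I2 : Ci * Ci = - (1)) by (unfold Ci, Cmult, Copp, RtoC; simpl; f_equal; ring).
        rewrite I2. ring. }
      rewrite EI. field.
    - rewrite <- RtoC_Cmod2, <- RtoC_opp, <- !RtoC_mult. simpl. ring. }
  assert (Hmono : forall s t, (s < t)%R -> (g t <= g s)%R).
  { intros s t Hst.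
    destruct (MVT_cor2 g (fun x => (- 4 * Im lambda * Cmod (u2 x) ^ 2)%R) s t Hst) as [x [Hx _]].
    { intros x _. apply is_derive_Reals. apply D. }
    assert (0 <= Im lambda * Cmod (u2 x) ^ 2)%R by (apply Rmult_le_pos; [exact Him|apply pow2_ge_0]).
    nra. }
  assert (Hlim : filterlim g (Rbar_locally m_infty) (locally 0%R)).
  { assert (K := Clim_plus _ _ _ _ _ (Clim_mult _ _ _ _ _ L1 (Clim_conj _ _ _ L1))
      (Clim_mult _ _ _ _ _ L2 (Clim_conj _ _ _ L2))).
    apply (Clim_components (Rbar_locally m_infty)) in K. destruct K as [K _].
    refine (filterlim_filter_le_2 _ _ K). cbn [fst snd]. rewrite Cconj_0.
    replace (0 * 0 + 0 * 0) with (RtoC 0) by ring. intros P HP. exact HP. }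
  intros t.
  assert (Hle : (g t <= 0)%R).
  { apply Rnot_lt_le. intros Hpos.
    assert (K := proj1 (filterlim_locally _ _) Hlim (mkposreal _ Hpos)).
    destruct K as [M HM].
    assert (Hs := HM (Rmin M t - 1)%R).
    assert (A1 := Rmin_l M t). assert (A2 := Rmin_r M t).
    specialize (Hs ltac:(lra)). assert (Hm := Hmono (Rmin M t - 1)%R t ltac:(lra)).
    unfold ball in Hs; simpl in Hs. unfold AbsRing_ball, abs, minus, plus, opp in Hs; simpl in Hs.
    apply Rabs_def2 in Hs. lra. }
  assert (Eg : g t = (Cmod (u1 t) ^ 2 + Cmod (u2 t) ^ 2)%R).
  { unfold g. rewrite <- !RtoC_Cmod2, <- RtoC_plus. reflexivity. }
  rewrite Eg in Hle.
  assert (C1 := Cmod_ge_0 (u1 t)). assert (C2 := Cmod_ge_0 (u2 t)).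
  rewrite (surjective_pairing (d t)).
  f_equal; apply (Cmult_eq_0_r (Cexp (Ci * lambda * t))); try apply Cexp_neq0;
    apply Cmod_eq_0; [change (Cmod (u1 t) = 0%R)|change (Cmod (u2 t) = 0%R)]; nra.
Qed.

Lemma jost_solution_unique (q : R -> C) (lambda : C) (phi chi : R -> C * C) :
  (0 <= Im lambda)%R ->
  is_jost_solution q lambda phi -> is_jost_solution q lambda chi -> phi = chi.
Proof.
  intros Him [P [P1 P2]] [X [X1 X2]].
  apply functional_extensionality. intros t.
  assert (Hz := zs_decaying_zero q lambda
    (fun s => (fst (phi s) - fst (chi s), snd (phi s) - snd (chi s))) Him).
  assert (E : (fst (phi t) - fst (chi t), snd (phi t) - snd (chi t)) = (RtoC 0, RtoC 0)).
  { apply Hz.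
    - intros s. destruct (P s) as [A1 A2]. destruct (X s) as [B1 B2]. cbn [fst snd]. split.
      + refine (Cderive_eq _ _ _ _ _ (Cderive_minus _ _ _ _ _ A1 B1)). ring.
      + refine (Cderive_eq _ _ _ _ _ (Cderive_minus _ _ _ _ _ A2 B2)). ring.
    - split; cbn [fst snd vscal].
      + replace (RtoC 0) with (RtoC 1 - RtoC 1) by ring.
        apply (filterlim_ext (fun t : R => Cexp (Ci * lambda * t) * fst (phi t) - Cexp (Ci * lambda * t) * fst (chi t))).
        { intros s. ring. }
        exact (Clim_minus _ _ _ _ _ P1 X1).
      + replace (RtoC 0) with (RtoC 0 - RtoC 0) by ring.
        apply (filterlim_ext (fun t : R => Cexp (Ci * lambda * t) * snd (phi t) - Cexp (Ci * lambda * t) * snd (chi t))).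
        { intros s. ring. }
        exact (Clim_minus _ _ _ _ _ P2 X2). }
  apply pair_equal_spec in E. destruct E as [E1 E2].
  rewrite (surjective_pairing (phi t)), (surjective_pairing (chi t)).
  f_equal; apply Ceq_minus; assumption.
Qed.

(** * Iterated Darboux steps *)

(** The matrix [T_n ... T_1] at the time [t] and the spectral parameter [mu],
    applied to an arbitrary vector [z]; the recursion of the definitions only
    applies it to the vectors [v_init] at their own spectral parameters. *)
Fixpoint dressing (N : nat) (lam Qd : nat -> C) (n : nat) (mu : C) (t : R)
  (z : C * C) : C * C :=
  match n with
  | O => z
  | S i => darboux_step (lam (S i)) (darboux_v N lam Qd i (S i) t) mu
             (dressing N lam Qd i mu t z)
  end.

Lemma darboux_v_dressing (N : nat) (lam Qd : nat -> C) (n k : nat) (t : R) :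
  darboux_v N lam Qd n k t =
  dressing N lam Qd n (lam k) t (v_init N lam Qd k t).
Proof.
  induction n as [|n IH]; [reflexivity|]. cbn [darboux_v dressing]. rewrite IH.
  reflexivity.
Qed.

Lemma dressing_vadd (N : nat) (lam Qd : nat -> C) (n : nat) (mu : C) (t : R)
  (u v : C * C) :
  dressing N lam Qd n mu t (vadd u v) =
  vadd (dressing N lam Qd n mu t u) (dressing N lam Qd n mu t v).
Proof.
  induction n as [|n IH]; [reflexivity|]. cbn [dressing]. rewrite IH.
  apply darboux_step_vadd.
Qed.

Lemma dressing_vscal (N : nat) (lam Qd : nat -> C) (n : nat) (mu c : C) (t : R)
  (v : C * C) :
  dressing N lam Qd n mu t (vscal c v) = vscal c (dressing N lam Qd n mu t v).
Proof.
  induction n as [|n IH]; [reflexivity|]. cbn [dressing]. rewrite IH.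
  apply darboux_step_vscal.
Qed.

Definition distinct_upper (N : nat) (lam : nat -> C) : Prop :=
  (forall i k, (1 <= i <= N)%nat -> (1 <= k <= N)%nat -> i <> k -> lam i <> lam k) /\
  (forall i, (1 <= i <= N)%nat -> (0 < Im (lam i))%R).

Lemma upper_neq_conj (l mu : C) : (0 <= Im mu)%R -> (0 < Im l)%R -> mu <> Cconj l.
Proof. intros Hm Hl E. rewrite E, im_conj in Hm. lra. Qed.

Lemma v_init_neq0 (N : nat) (lam Qd : nat -> C) (k : nat) (t : R) :
  v_init N lam Qd k t <> (RtoC 0, RtoC 0).
Proof.
  intros E. apply pair_equal_spec in E. destruct E as [E _].
  revert E. apply Cmult_neq_0; [apply C1_nz | apply Cexp_neq0].
Qed.

Lemma dressing_neq0 (N : nat) (lam Qd : nat -> C) (n : nat) :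
  distinct_upper N lam -> (n <= N)%nat ->
  forall (mu : C) (t : R) (z : C * C),
    (0 <= Im mu)%R -> (forall i, (1 <= i <= n)%nat -> mu <> lam i) ->
    z <> (RtoC 0, RtoC 0) -> dressing N lam Qd n mu t z <> (RtoC 0, RtoC 0).
Proof.
  intros [Hd HI]. induction n as [|n IH]; intros Hn mu t z Hmu Hi Hz; [exact Hz|].
  cbn [dressing]. apply darboux_step_injective.
  - rewrite darboux_v_dressing. apply IH; [lia| | |apply v_init_neq0].
    + apply Rlt_le, HI. lia.
    + intros i Hin. apply Hd; lia.
  - apply Hi. lia.
  - apply upper_neq_conj; [exact Hmu|apply HI; lia].
  - apply IH; [lia|exact Hmu| |exact Hz]. intros i Hin. apply Hi. lia.
Qed.

Lemma darboux_v_neq0 (N : nat) (lam Qd : nat -> C) (n k : nat) (t : R) :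
  distinct_upper N lam -> (n < k <= N)%nat ->
  darboux_v N lam Qd n k t <> (RtoC 0, RtoC 0).
Proof.
  intros H Hk. rewrite darboux_v_dressing.
  apply dressing_neq0; [exact H|lia| | |apply v_init_neq0].
  - apply Rlt_le, (proj2 H). lia.
  - intros i Hi. apply (proj1 H); lia.
Qed.

(** After [i - 1] steps the vector [v_init i] has become the vector that
    determines step [i], which that step annihilates. *)
Lemma dressing_kernel (N : nat) (lam Qd : nat -> C) (n i : nat) (t : R) :
  distinct_upper N lam -> (n <= N)%nat -> (1 <= i <= n)%nat ->
  dressing N lam Qd n (lam i) t (v_init N lam Qd i t) = (RtoC 0, RtoC 0).
Proof.
  intros H. induction n as [|n IH]; intros Hn Hi; [lia|]. cbn [dressing].
  destruct (Nat.eq_dec i (S n)) as [->|Hne].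
  - rewrite <- darboux_v_dressing. apply darboux_step_kernel.
    apply darboux_v_neq0; [exact H|lia].
  - rewrite IH by lia.
    replace (RtoC 0, RtoC 0) with (vscal 0 (RtoC 0, RtoC 0))
      by (unfold vscal; cbn [fst snd]; f_equal; ring).
    rewrite darboux_step_vscal. unfold vscal; f_equal; ring.
Qed.

Lemma free_solution (c d mu : C) :
  zs_solution (fun _ => RtoC 0) mu (fun t => (c * Cexp (- Ci * mu * t), d * Cexp (Ci * mu * t))).
Proof.
  intros t. cbn [fst snd]. split.
  - refine (Cderive_eq _ _ _ _ _ (Cderive_mult _ _ _ _ _ (Cderive_const c t) (Cderive_Cexp (- Ci * mu) t))).
    ring.
  - refine (Cderive_eq _ _ _ _ _ (Cderive_mult _ _ _ _ _ (Cderive_const d t) (Cderive_Cexp (Ci * mu) t))).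
    rewrite Cconj_0. ring.
Qed.

Lemma dressing_solution (N : nat) (lam Qd : nat -> C) (n : nat) :
  distinct_upper N lam -> (n <= N)%nat ->
  forall (mu : C) (v : R -> C * C),
    zs_solution (fun _ => RtoC 0) mu v ->
    zs_solution (darboux_q N lam Qd n) mu (fun t => dressing N lam Qd n mu t (v t)).
Proof.
  intros H. induction n as [|n IH]; intros Hn mu v Hv; [exact Hv|].
  refine (darboux_step_solution (darboux_q N lam Qd n) (lam (S n)) mu
    (fun t => darboux_v N lam Qd n (S n) t) _ _ _ (IH _ mu v Hv)); [| |lia].
  - intros t. apply darboux_v_neq0; [exact H|lia].
  - replace (fun t => darboux_v N lam Qd n (S n) t) with
      (fun t => dressing N lam Qd n (lam (S n)) t (v_init N lam Qd (S n) t))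
      by (apply functional_extensionality; intros t; symmetry; apply darboux_v_dressing).
    apply IH; [lia|]. apply free_solution.
Qed.

Lemma seq_1_In (k n : nat) : In k (seq 1 n) <-> (1 <= k <= n)%nat.
Proof. rewrite in_seq. lia. Qed.

Lemma vlim_eq (F : (R -> Prop) -> Prop) (u : R -> C * C) (l m : C * C) :
  l = m -> vlim F u l -> vlim F u m.
Proof. intros E H. rewrite <- E. exact H. Qed.

Lemma vlim_ext (F : (R -> Prop) -> Prop) {FF : Filter F} (u v : R -> C * C) (l : C * C) :
  (forall t, u t = v t) -> vlim F u l -> vlim F v l.
Proof.
  intros E [H1 H2]. split.
  - refine (filterlim_ext _ _ _ H1). intros t. rewrite E. reflexivity.
  - refine (filterlim_ext _ _ _ H2). intros t. rewrite E. reflexivity.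
Qed.

(** At [+oo] every step becomes diagonal.  By induction, the vector determining
    step [n + 1], rescaled by [e^{j L t}] with [L = lam (n + 1)], tends to
    [(c, 0)], where [c] is a product of the differences [L - lam_i]; it is here
    that the [lam_i] must be distinct. *)
Lemma dressing_vlim_p_infty (N : nat) (lam Qd : nat -> C) (n : nat) :
  distinct_upper N lam -> (n <= N)%nat ->
  forall (mu : C) (v : R -> C * C) (z : C * C),
    vlim (Rbar_locally p_infty) v z ->
    vlim (Rbar_locally p_infty) (fun t => dressing N lam Qd n mu t (v t))
      (Cprod (fun i => mu - lam i) (seq 1 n) * fst z,
       Cprod (fun i => mu - Cconj (lam i)) (seq 1 n) * snd z).
Proof.
  intros H. induction n as [|n IH]; intros Hn mu v z Hv.
  - refine (vlim_eq _ _ _ _ _ Hv). rewrite (surjective_pairing z).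
    unfold Cprod; cbn [map fold_right seq fst snd]. f_equal; ring.
  - set (L := lam (S n)). set (c := Cprod (fun i => L - lam i) (seq 1 n)).
    assert (HL : (0 < Im L)%R) by (apply (proj2 H); lia).
    assert (Hc : c <> 0).
    { apply Cprod_neq0. intros k Hk. apply seq_1_In in Hk.
      apply Cminus_eq_contra. apply (proj1 H); lia. }
    assert (Hp : (c, RtoC 0) <> (RtoC 0, RtoC 0)).
    { intros E. apply pair_equal_spec in E. apply Hc, E. }
    cbn [dressing].
    refine (vlim_eq _ _ _ _ _ (darboux_step_vlim _ L mu (fun t => Cexp (Ci * L * t))
      (fun t => darboux_v N lam Qd n (S n) t) _ (c, RtoC 0) _ _ _ Hp _ (IH _ mu v z Hv)));
      [| | | |lia].
    + rewrite darboux_step_axis1 by exact Hc. cbn [fst snd].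
      rewrite !Cprod_seq_S. f_equal; unfold L; ring.
    + intros t. apply Cexp_neq0.
    + intros t. apply darboux_v_neq0; [exact H|lia].
    + apply (vlim_ext _ (fun t => dressing N lam Qd n L t
        (RtoC 1, Bcoef N lam Qd (S n) * Cexp (2 * Ci * L * t)))).
      { intros t. rewrite darboux_v_dressing. fold L. rewrite <- dressing_vscal. f_equal.
        unfold vscal, v_init; cbn [fst snd]. fold L. f_equal.
        - symmetry. etransitivity; [|exact (Cexp_opp_l (Ci * L * t))].
          replace (- Ci * L * t) with (- (Ci * L * t)) by ring. ring.
        - replace (2 * Ci * L * t) with (Ci * L * t + Ci * L * t) by ring.
          rewrite Cexp_plus. ring. }
      refine (vlim_eq _ _ _ _ _ (IH _ L _ (RtoC 1, RtoC 0) _)); [|lia|].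
      { cbn [fst snd]. unfold c. f_equal; ring. }
      split; cbn [fst snd]; [apply filterlim_const|].
      replace (RtoC 0) with (Bcoef N lam Qd (S n) * 0) by ring.
      refine (Clim_mult _ _ _ _ _ (filterlim_const _) _).
      apply Cexp_lim_p_infty. unfold Ci, Cmult, RtoC, Re; simpl.
      unfold Im in HL. lra.
Qed.

(** The mirror image at [-oo]: rescaled by [e^{- j L t}], the vector determining
    step [n + 1] tends to [(0, c)].  The surviving component carries the factor
    [Bcoef], which therefore has to be nonzero. *)
Lemma dressing_vlim_m_infty (N : nat) (lam Qd : nat -> C) (n : nat) :
  distinct_upper N lam -> (forall i, (1 <= i <= N)%nat -> Bcoef N lam Qd i <> 0) ->
  (n <= N)%nat ->
  forall (mu : C) (v : R -> C * C) (z : C * C),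
    vlim (Rbar_locally m_infty) v z ->
    vlim (Rbar_locally m_infty) (fun t => dressing N lam Qd n mu t (v t))
      (Cprod (fun i => mu - Cconj (lam i)) (seq 1 n) * fst z,
       Cprod (fun i => mu - lam i) (seq 1 n) * snd z).
Proof.
  intros H HB. induction n as [|n IH]; intros Hn mu v z Hv.
  - refine (vlim_eq _ _ _ _ _ Hv). rewrite (surjective_pairing z).
    unfold Cprod; cbn [map fold_right seq fst snd]. f_equal; ring.
  - set (L := lam (S n)).
    set (c := Cprod (fun i => L - lam i) (seq 1 n) * Bcoef N lam Qd (S n)).
    assert (HL : (0 < Im L)%R) by (apply (proj2 H); lia).
    assert (Hc : c <> 0).
    { apply Cmult_neq_0; [|apply HB; lia].
      apply Cprod_neq0. intros k Hk. apply seq_1_In in Hk.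
      apply Cminus_eq_contra. apply (proj1 H); lia. }
    assert (Hp : (RtoC 0, c) <> (RtoC 0, RtoC 0)).
    { intros E. apply pair_equal_spec in E. apply Hc, E. }
    cbn [dressing].
    refine (vlim_eq _ _ _ _ _ (darboux_step_vlim _ L mu (fun t => Cexp (- Ci * L * t))
      (fun t => darboux_v N lam Qd n (S n) t) _ (RtoC 0, c) _ _ _ Hp _ (IH _ mu v z Hv)));
      [| | | |lia].
    + rewrite darboux_step_axis2 by exact Hc. cbn [fst snd].
      rewrite !Cprod_seq_S. f_equal; unfold L; ring.
    + intros t. apply Cexp_neq0.
    + intros t. apply darboux_v_neq0; [exact H|lia].
    + apply (vlim_ext _ (fun t => dressing N lam Qd n L t
        (Cexp (- (2) * Ci * L * t), Bcoef N lam Qd (S n)))).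
      { intros t. rewrite darboux_v_dressing. fold L. rewrite <- dressing_vscal. f_equal.
        unfold vscal, v_init; cbn [fst snd]. fold L. f_equal.
        - replace (- (2) * Ci * L * t) with (- Ci * L * t + - Ci * L * t) by ring.
          rewrite Cexp_plus. ring.
        - replace (Cexp (- Ci * L * t) * (Bcoef N lam Qd (S n) * Cexp (Ci * L * t)))
            with (Bcoef N lam Qd (S n) * (Cexp (- (Ci * L * t)) * Cexp (Ci * L * t))).
          + rewrite Cexp_opp_l. ring.
          + replace (- Ci * L * t) with (- (Ci * L * t)) by ring. ring. }
      refine (vlim_eq _ _ _ _ _ (IH _ L _ (RtoC 0, Bcoef N lam Qd (S n)) _)); [|lia|].
      { cbn [fst snd]. unfold c. f_equal; ring. }
      split; cbn [fst snd]; [|apply filterlim_const].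
      apply Cexp_lim_m_infty. unfold Ci, Cmult, Copp, RtoC, Re; simpl.
      unfold Im in HL. lra.
Qed.

(** * Scattering data of the dressed potential *)

Definition blaschke_num (N : nat) (lam : nat -> C) (mu : C) : C :=
  Cprod (fun i => mu - lam i) (seq 1 N).
Definition blaschke_den (N : nat) (lam : nat -> C) (mu : C) : C :=
  Cprod (fun i => mu - Cconj (lam i)) (seq 1 N).

Lemma blaschke_den_neq0 (N : nat) (lam : nat -> C) (mu : C) :
  distinct_upper N lam -> (0 <= Im mu)%R -> blaschke_den N lam mu <> 0.
Proof.
  intros H Hmu. apply Cprod_neq0. intros k Hk. apply seq_1_In in Hk.
  apply Cminus_eq_contra, upper_neq_conj; [exact Hmu|apply (proj2 H), Hk].
Qed.

Lemma Bcoef_others (N : nat) (lam Qd : nat -> C) (i : nat) :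
  distinct_upper N lam -> (1 <= i <= N)%nat ->
  Bcoef N lam Qd i = - (Qd i / (lam i - Cconj (lam i))) *
    (Cprod (fun k => lam i - lam k) (others i (seq 1 N)) /
     Cprod (fun k => lam i - Cconj (lam k)) (others i (seq 1 N))).
Proof.
  intros H Hi. rewrite <- Cprod_div; [reflexivity|].
  intros k Hk. unfold others in Hk. apply filter_In in Hk. destruct Hk as [Hk _].
  apply seq_1_In in Hk. apply Cminus_eq_contra, upper_neq_conj.
  - apply Rlt_le, (proj2 H), Hi.
  - apply (proj2 H), Hk.
Qed.

Lemma others_num_neq0 (N : nat) (lam : nat -> C) (i : nat) :
  distinct_upper N lam -> (1 <= i <= N)%nat ->
  Cprod (fun k => lam i - lam k) (others i (seq 1 N)) <> 0.
Proof.
  intros H Hi. apply Cprod_neq0. intros k Hk. unfold others in Hk.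
  apply filter_In in Hk. destruct Hk as [Hk Hki]. apply seq_1_In in Hk.
  apply Cminus_eq_contra. apply (proj1 H); [exact Hi|exact Hk|].
  intros ->. rewrite Nat.eqb_refl in Hki. discriminate.
Qed.

Lemma blaschke_den_others (N : nat) (lam : nat -> C) (i : nat) (mu : C) :
  (1 <= i <= N)%nat ->
  blaschke_den N lam mu = (mu - Cconj (lam i)) *
    Cprod (fun k => mu - Cconj (lam k)) (others i (seq 1 N)).
Proof.
  intros Hi. apply (Cprod_others (fun k => mu - Cconj (lam k)));
    [apply seq_NoDup|apply seq_1_In, Hi].
Qed.

Lemma blaschke_num_others (N : nat) (lam : nat -> C) (i : nat) (mu : C) :
  (1 <= i <= N)%nat ->
  blaschke_num N lam mu = (mu - lam i) * Cprod (fun k => mu - lam k) (others i (seq 1 N)).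
Proof.
  intros Hi. apply (Cprod_others (fun k => mu - lam k));
    [apply seq_NoDup|apply seq_1_In, Hi].
Qed.

Lemma Bcoef_neq0 (N : nat) (lam Qd : nat -> C) (i : nat) :
  distinct_upper N lam -> (1 <= i <= N)%nat -> Qd i <> 0 -> Bcoef N lam Qd i <> 0.
Proof.
  intros H Hi HQ. rewrite Bcoef_others by assumption.
  assert (HD := blaschke_den_neq0 N lam (lam i) H (Rlt_le _ _ (proj2 H i Hi))).
  rewrite (blaschke_den_others N lam i (lam i) Hi) in HD.
  assert (Hn := others_num_neq0 N lam i H Hi).
  intros E. apply (Cmult_neq_0 _ _ HQ Hn).
  transitivity (- ((lam i - Cconj (lam i)) *
      Cprod (fun k => lam i - Cconj (lam k)) (others i (seq 1 N)))
    * (- (Qd i / (lam i - Cconj (lam i))) *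
    (Cprod (fun k => lam i - lam k) (others i (seq 1 N)) /
     Cprod (fun k => lam i - Cconj (lam k)) (others i (seq 1 N))))).
  - field. split; intros K; apply HD; rewrite K; ring.
  - rewrite E. ring.
Qed.

(** The null second component keeps the shape of [free_solution]; the factor in
    front makes the limit at [-oo] equal to [1]. *)
Definition dressed_jost (N : nat) (lam Qd : nat -> C) (mu : C) (t : R) : C * C :=
  dressing N lam Qd N mu t
    (/ blaschke_den N lam mu * Cexp (- Ci * mu * t), 0 * Cexp (Ci * mu * t)).

Lemma dressed_jost_normalised (N : nat) (lam Qd : nat -> C) (mu : C) (t : R) :
  vscal (Cexp (Ci * mu * t)) (dressed_jost N lam Qd mu t) =
  dressing N lam Qd N mu t (/ blaschke_den N lam mu, RtoC 0).
Proof.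
  unfold dressed_jost. rewrite <- dressing_vscal. f_equal. unfold vscal; cbn [fst snd].
  f_equal; [|ring].
  transitivity (/ blaschke_den N lam mu * (Cexp (- (Ci * mu * t)) * Cexp (Ci * mu * t))).
  - replace (- Ci * mu * t) with (- (Ci * mu * t)) by ring. ring.
  - rewrite Cexp_opp_l. ring.
Qed.

Lemma vlim_const (F : (R -> Prop) -> Prop) {FF : Filter F} (z : C * C) :
  vlim F (fun _ => z) z.
Proof. split; apply filterlim_const. Qed.

Lemma dressed_jost_correct (N : nat) (lam Qd : nat -> C) (mu : C) :
  distinct_upper N lam -> (forall i, (1 <= i <= N)%nat -> Qd i <> 0) ->
  (0 <= Im mu)%R ->
  is_jost_solution (darboux_q N lam Qd N) mu (dressed_jost N lam Qd mu).
Proof.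
  intros H HQ Hmu. split.
  - apply (dressing_solution N lam Qd N H (le_n N) mu). apply free_solution.
  - apply (vlim_ext (Rbar_locally m_infty) _ _ (RtoC 1, RtoC 0)
      (fun t => eq_sym (dressed_jost_normalised N lam Qd mu t))).
    refine (vlim_eq _ _ _ _ _ (dressing_vlim_m_infty N lam Qd N H _ (le_n N) mu _
      (/ blaschke_den N lam mu, RtoC 0) (vlim_const _ _))).
    + cbn [fst snd]. f_equal; [|ring]. apply Cinv_r. apply blaschke_den_neq0; assumption.
    + intros i Hi. apply Bcoef_neq0; auto.
Qed.

Lemma dressed_jost_unique (N : nat) (lam Qd : nat -> C) (mu : C) :
  distinct_upper N lam -> (forall i, (1 <= i <= N)%nat -> Qd i <> 0) ->
  (0 <= Im mu)%R ->
  unique (is_jost_solution (darboux_q N lam Qd N) mu) (dressed_jost N lam Qd mu).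
Proof.
  intros H HQ Hmu. assert (J := dressed_jost_correct N lam Qd mu H HQ Hmu).
  split; [exact J|]. intros chi Hchi.
  exact (jost_solution_unique _ _ _ _ Hmu J Hchi).
Qed.

(** By [dressing_kernel], subtracting a multiple of [v_init i] from the undressed
    Jost solution does not change the dressed one; this trades
    [(e^{- j mu t}, 0)] for [(0, - B e^{j mu t})], whose dressing is of the order
    of [e^{j mu t}] at [+oo]. *)
Lemma dressed_jost_b (N : nat) (lam Qd : nat -> C) (i : nat) :
  distinct_upper N lam -> (forall i, (1 <= i <= N)%nat -> Qd i <> 0) ->
  (1 <= i <= N)%nat ->
  is_scattering_b (darboux_q N lam Qd N) (lam i) (- Bcoef N lam Qd i).
Proof.
  intros H HQ Hi. assert (Hmu := Rlt_le _ _ (proj2 H i Hi)).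
  assert (HD := blaschke_den_neq0 N lam (lam i) H Hmu).
  exists (dressed_jost N lam Qd (lam i)). split; [apply dressed_jost_unique; assumption|].
  set (mu := lam i) in *. set (B := Bcoef N lam Qd i).
  assert (E : forall t : R, vscal (Cexp (- Ci * mu * t)) (dressed_jost N lam Qd mu t) =
    dressing N lam Qd N mu t (RtoC 0, - B / blaschke_den N lam mu)).
  { intros t. unfold dressed_jost. rewrite <- dressing_vscal.
    replace (vscal _ _) with
      (vadd (vscal (/ blaschke_den N lam mu * Cexp (- Ci * mu * t)) (v_init N lam Qd i t))
         (RtoC 0, - B / blaschke_den N lam mu)).
    - rewrite dressing_vadd, dressing_vscal.
      unfold mu at 3. rewrite dressing_kernel by (auto; lia).
      unfold vadd, vscal; cbn [fst snd].
      rewrite (surjective_pairing (dressing N lam Qd N mu t (RtoC 0, - B / blaschke_den N lam mu))) at 3.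
      f_equal; ring.
    - unfold vadd, vscal, v_init; cbn [fst snd]. fold mu B. f_equal; [ring|].
      transitivity (/ blaschke_den N lam mu * B * (Cexp (- (Ci * mu * t)) * Cexp (Ci * mu * t)) - B / blaschke_den N lam mu).
      + replace (- Ci * mu * t) with (- (Ci * mu * t)) by ring. unfold Cdiv. ring.
      + rewrite Cexp_opp_l. unfold Cdiv. ring. }
  refine (proj2 (vlim_ext (Rbar_locally p_infty) _ _ (RtoC 0, - B) (fun t => eq_sym (E t)) _)).
  refine (vlim_eq _ _ _ _ _ (dressing_vlim_p_infty N lam Qd N H (le_n N) mu _ _ (vlim_const _ _))).
  cbn [fst snd]. fold (blaschke_den N lam mu). f_equal; [ring|]. field. exact HD.
Qed.

Theorem mainTheorem2 (N : nat) (lam Qd : nat -> C)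
  (Hdistinct : forall i k : nat,
     (1 <= i <= N)%nat -> (1 <= k <= N)%nat -> i <> k -> lam i <> lam k)
  (HIm : forall i : nat, (1 <= i <= N)%nat -> (0 < Im (lam i))%R)
  (HQd : forall i : nat, (1 <= i <= N)%nat -> Qd i <> 0) :
  exists a : C -> C,
    is_scattering_function_a (darboux_q N lam Qd N) a /\
    (forall lambda : C,
       is_eigenvalue a lambda <->
       exists i : nat, (1 <= i <= N)%nat /\ lambda = lam i) /\
    (forall i : nat, (1 <= i <= N)%nat ->
       is_discrete_amplitude (darboux_q N lam Qd N) a (lam i) (Qd i)).
Proof.
  assert (H : distinct_upper N lam) by (split; assumption).
  set (a := fun mu => blaschke_num N lam mu / blaschke_den N lam mu).
  assert (Hroot : forall i, (1 <= i <= N)%nat -> is_eigenvalue a (lam i)).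
  { intros i Hi. split; [exact (HIm i Hi)|]. unfold a.
    rewrite (blaschke_num_others N lam i (lam i) Hi). unfold Cdiv. ring. }
  exists a. split; [|split].
  - intros mu Hmu. exists (dressed_jost N lam Qd mu). split; [apply dressed_jost_unique; assumption|].
    refine (proj1 (vlim_ext (Rbar_locally p_infty) _ _ (a mu, RtoC 0)
      (fun t => eq_sym (dressed_jost_normalised N lam Qd mu t)) _)).
    refine (vlim_eq _ _ _ _ _ (dressing_vlim_p_infty N lam Qd N H (le_n N) mu _ _ (vlim_const _ _))).
    cbn [fst snd]. f_equal. ring.
  - intros mu. split.
    + intros [Hmu Ha].
      assert (HD := blaschke_den_neq0 N lam mu H (Rlt_le _ _ Hmu)).
      assert (HP : blaschke_num N lam mu = 0).
      { transitivity (a mu * blaschke_den N lam mu); [unfold a; field; exact HD|].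
        rewrite Ha. ring. }
      apply Cprod_eq_0 in HP. destruct HP as [i [Hi E]].
      exists i. split; [apply seq_1_In, Hi | apply Ceq_minus, E].
    + intros [i [Hi ->]]. apply Hroot, Hi.
  - intros i Hi. split; [apply Hroot, Hi|].
    assert (HD := blaschke_den_neq0 N lam (lam i) H (Rlt_le _ _ (HIm i Hi))).
    assert (Hn := others_num_neq0 N lam i H Hi).
    set (g := fun mu => Cprod (fun k => mu - lam k) (others i (seq 1 N)) / blaschke_den N lam mu).
    exists (g (lam i)), (- Bcoef N lam Qd i). split; [|split; [|split]].
    + apply Cderive_simple_zero.
      * intros mu. unfold a, g. rewrite (blaschke_num_others N lam i mu Hi). unfold Cdiv. ring.
      * assert (Hlin : forall c : C, filterlim (fun mu : C => mu - c) (locally (lam i)) (locally (lam i - c))).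
        { intros c. exact (Clim_minus _ _ _ _ _ (filterlim_id _ _) (filterlim_const c)). }
        apply (Clim_div _ _ _ _ _ HD).
        -- exact (Clim_Cprod _ _ _ _ (fun k => Hlin (lam k))).
        -- exact (Clim_Cprod _ _ _ _ (fun k => Hlin (Cconj (lam k)))).
    + intros E. apply Hn. transitivity (g (lam i) * blaschke_den N lam (lam i)).
      * unfold g. field. exact HD.
      * rewrite E. ring.
    + apply dressed_jost_b; assumption.
    + unfold g. rewrite Bcoef_others by assumption.
      rewrite (blaschke_den_others N lam i (lam i) Hi) in *. field.
      repeat split; try exact Hn; intros K; apply HD; rewrite K; ring.
Qed.
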